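(* Let $G$ be a finitely generated soluble group which is not an Engel group. Then the Engel graph $\mathcal{E}_G$ has no infinite clique if and only if the clique number of $\mathcal{E}_G$ is finite.
   Context: For elements of a group, $[x,y]=x^{-1}y^{-1}xy$, and $[x,_k y]$ is defined by $[x,_0 y]=x$, $[x,_k y]=[[x,_{k-1}y],y]$ for $k\ge 1$. An element $x\in G$ is left Engel if for every $a\in G$ there is a positive integer $k$ with $[a,_k x]=1$; $L(G)$ is the set of left Engel elements of $G$. $G$ is an Engel group if $L(G)=G$, and non-Engel otherwise. For a non-Engel group $G$, the Engel graph $\mathcal{E}_G$ is the simple graph with vertex set $G\setminus L(G)$ in which two distinct vertices $x,y$ are adjacent iff $[x,_k y]\neq 1$ and $[y,_k x]\neq 1$ for all positive integers $k$. A clique of a graph is a set of pairwise adjacent vertices. The clique number is the largest size of a clique, if it exists; the clique number being finite means that there is a finite bound on the sizes of all cliques. *)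

(* Defs.v *)
From mathcomp Require Import all_boot.
From mathcomp Require Import boolp classical_sets functions cardinality.

Set Implicit Arguments.
Unset Strict Implicit.
Unset Printing Implicit Defensive.

Local Open Scope classical_set_scope.
Local Open Scope group_scope.

(** Groups are MathComp's [groupType], which are not assumed finite. Since
    [boolp] equips every type with a choice structure, asking for a
    [choiceType] carrier excludes no group. Subgroups are classical sets. *)

Section Groups.
Variable G : groupType.
Implicit Types (S H K : set G) (x y : G) (k n : nat).

Definition subgroup H : Prop :=
  [/\ H 1, forall x y, H x -> H y -> H (x * y) & forall x, H x -> H x^-1].

Definition generated S : set G := smallest subgroup S.

Definition finitely_generated : Prop :=
  exists S, finite_set S /\ generated S = [set: G].

Definition commutator_subgroup H K : set G :=
  generated [set z | exists x y, [/\ H x, K y & z = [~ x, y]]].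

Fixpoint derived_series n : set G :=
  if n is m.+1 then commutator_subgroup (derived_series m) (derived_series m)
  else [set: G].

Definition soluble : Prop := exists n, derived_series n = [set 1].

(** [iter_comm x k y] is [x,_k y], the left-normed commutator [x, y, ..., y]
    with [k] entries [y]; MathComp's [~ x, y] unfolds to
    x^-1 * (y^-1 * (x * y)). *)
Definition iter_comm x k y : G := iter k (fun z => [~ z, y]) x.

Definition left_Engel : set G :=
  [set x | forall a : G, exists k, (0 < k)%N /\ iter_comm a k x = 1].

Definition Engel_group : Prop := left_Engel = [set: G].

End Groups.

Arguments finitely_generated G : clear implicits.
Arguments derived_series G n : clear implicits.
Arguments soluble G : clear implicits.
Arguments left_Engel G : clear implicits.
Arguments Engel_group G : clear implicits.

(** A simple graph whose vertices form a subset of [T]. *)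
Record simple_graph (T : Type) := SimpleGraph {
  vertices : set T;
  adjacent : T -> T -> Prop;
  adjacent_vertices : forall x y, adjacent x y -> vertices x /\ vertices y;
  adjacent_sym : forall x y, adjacent x y -> adjacent y x;
  adjacent_irrefl : forall x, ~ adjacent x x
}.

Section Cliques.
Variables (T : Type) (E : simple_graph T).

Definition clique (C : set T) : Prop :=
  C `<=` vertices E /\
  forall x y, C x -> C y -> x <> y -> adjacent E x y.

Definition has_infinite_clique : Prop :=
  exists C : set T, clique C /\ infinite_set C.

(** [`I_n] is {0, ..., n-1} and [#<=] compares cardinals, so this says that
    every clique has at most [n] elements. *)
Definition finite_clique_number : Prop :=
  exists n : nat, forall C : set T, clique C -> (C #<= `I_n)%card.

End Cliques.

Section EngelGraph.
Variable G : groupType.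

Definition Engel_vertices : set G := [set: G] `\` left_Engel G.

Definition Engel_adjacent (x y : G) : Prop :=
  [/\ Engel_vertices x, Engel_vertices y, x <> y &
      forall k, (0 < k)%N -> iter_comm x k y <> 1 /\ iter_comm y k x <> 1].

Lemma Engel_adjacent_vertices x y :
  Engel_adjacent x y -> Engel_vertices x /\ Engel_vertices y.
Proof. by case. Qed.

Lemma Engel_adjacent_sym x y : Engel_adjacent x y -> Engel_adjacent y x.
Proof.
case=> Vx Vy xy adj; split=> //; first by move/esym.
by move=> k /adj[].
Qed.

Lemma Engel_adjacent_irrefl x : ~ Engel_adjacent x x.
Proof. by case. Qed.

Definition Engel_graph : simple_graph G :=
  SimpleGraph Engel_adjacent_vertices Engel_adjacent_sym Engel_adjacent_irrefl.

End EngelGraph.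

Arguments Engel_graph G : clear implicits.

(* Main.v *)
Require Import Defs.
From HB Require Import structures.
From mathcomp Require Import all_boot generic_quotient.
From mathcomp Require Import boolp classical_sets functions cardinality.

(** If the graph has bounded cliques it has no infinite one; the content is the
converse. It suffices to find a normal subgroup R of finite index all of whose
elements r are right Engel, i.e. for every y some [r,_k y] is 1: if x = y r
then [x, y] = [r, y], so [x,_k y] = 1 for some k, and hence a clique meets each
coset of R at most once.

The absence of infinite cliques is used only in the following form
([Engel_sequences]): among the terms of any sequence there are x_i, x_j with
i < j such that [x_i,_k x_j] or [x_j,_k x_i] is 1 for some k. This property
passes to quotients. If A is an abelian normal subgroup, it can be applied to
y a_0, y a_1, ... with all a_i in A; as z |-> [z, y] is an endomorphism of A
that is unchanged when y is multiplied by an element of A, one gets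
[a_i^-1 a_j,_k y] = 1 for some i < j and some k ([Engel_abelian_sequence]).
Two choices of the sequence carry the proof.

With a_i = a^(g^i), this shows that the smallest subgroup containing a and
invariant under g is finitely generated. The same then holds for every element
of G in place of a, provided that G/A is noetherian
([restrained_over_abelian]). For a finitely generated extension of L by a
cyclic group generated by the image of g, this local condition forces L to be
finitely generated ([fg_cyclic_extension]). Going down a series with cyclic
factors from G to the last nontrivial term A of the derived series, A is
finitely generated, and G is polycyclic by induction on the derived length
([Engel_soluble_polycyclic]); in particular every subgroup of G is finitely
generated.

With a_i = a^i, one gets that a power of [a,_k y] is 1, so that
[a^m,_k y] = [a,_k y]^m = 1, where m is an exponent of the torsion subgroup of
A. Thus A^m consists of right Engel elements. When G is infinite, A can be
taken infinite: the centre of the last infinite term D of the derived series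
is infinite, because D is finitely generated with finite derived subgroup.
As A is finitely generated, A^m is then nontrivial ([right_Engel_normal]).

Finally let R be maximal among the normal subgroups made of right Engel
elements. If G/R were infinite, a nontrivial normal subgroup of right Engel
elements of G/R would lift to one of G larger than R. So G/R is finite. *)

Set Implicit Arguments.
Unset Strict Implicit.
Unset Printing Implicit Defensive.

Local Open Scope classical_set_scope.
Local Open Scope quotient_scope.
Local Open Scope group_scope.

(** * Subgroups and generators *)

Section Subgroups.
Variable G : groupType.
Implicit Types (A B D H K L S T U : set G) (a g h x y z : G).

Definition fg_subgroup H : Prop := exists2 S, finite_set S & generated S = H.

Definition normal K : Prop := subgroup K /\ forall x g, K x -> K (x ^ g).

Definition abelian H : Prop := forall x y, H x -> H y -> x * y = y * x.

Lemma generated_subgroup S : subgroup (generated S).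
Proof.
split=> [A [[]]//|x y Sx Sy A [gA SA]|x Sx A [gA SA]].
  by case: (gA) => _ + _; apply; [apply: Sx|apply: Sy].
by case: (gA) => _ _; apply; apply: Sx.
Qed.

Lemma sub_generated S : S `<=` generated S.
Proof. exact: sub_gen_smallest. Qed.

Lemma generated_sub S H : subgroup H -> S `<=` H -> generated S `<=` H.
Proof. exact: smallest_sub. Qed.

Lemma generated_mono S T : S `<=` T -> generated S `<=` generated T.
Proof.
by move=> ST; apply: generated_sub (generated_subgroup _) _ => x /ST/sub_generated.
Qed.

Lemma subgroupT : subgroup [set: G]. Proof. by []. Qed.

Lemma subgroup1 : subgroup [set (1 : G)].
Proof. by split=> [//|x y -> ->|x ->]; rewrite /= ?mulg1 ?invg1. Qed.

Section SubgroupTheory.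
Variable H : set G.
Hypothesis gH : subgroup H.

Lemma memg1 : H 1. Proof. by case: gH. Qed.

Lemma memgM x y : H x -> H y -> H (x * y).
Proof. by case: gH => _ + _; apply. Qed.

Lemma memgV x : H x -> H x^-1. Proof. by case: gH => _ _; apply. Qed.

Lemma memgX x n : H x -> H (x ^+ n).
Proof.
move=> Hx; elim: n => [|n IH]; first by rewrite expg0; apply: memg1.
by rewrite expgS; apply: memgM.
Qed.

Lemma memgMl x y : H x -> H (x * y) -> H y.
Proof.
by move=> Hx Hxy; rewrite -(mulKg x y); apply: memgM => //; apply: memgV.
Qed.

Lemma memgMr x y : H y -> H (x * y) -> H x.
Proof.
by move=> Hx Hxy; rewrite -(mulgK y x); apply: memgM => //; apply: memgV.
Qed.

End SubgroupTheory.

Lemma subgroupI H K : subgroup H -> subgroup K -> subgroup (H `&` K).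
Proof.
move=> gH gK; split=> [|x y [Hx Kx] [Hy Ky]|x [Hx Kx]].
- by split; apply: memg1.
- by split; apply: memgM.
- by split; apply: memgV.
Qed.

(** The product set H L, a subgroup when [H] normalizes [L]. *)
Definition join H L : set G := [set x | exists2 h, H h & L (h^-1 * x)].

Lemma join_subgroup H L : subgroup H -> subgroup L ->
  (forall h x, H h -> L x -> L (x ^ h)) -> subgroup (join H L).
Proof.
move=> gH gL nLH; split.
- by exists 1; [exact: memg1|rewrite mulg1 invg1; exact: memg1].
- move=> x y [h Hh Lx] [k Hk Ly]; exists (h * k); first exact: memgM.
  have -> : (h * k)^-1 * (x * y) = (h^-1 * x) ^ k * (k^-1 * y).
    by rewrite /conjg !gnorm.
  by apply: memgM => //; apply: nLH.
- move=> x [h Hh Lx]; exists h^-1; first exact: memgV.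
  have -> : h^-1^-1 * x^-1 = ((h^-1 * x)^-1) ^ h^-1 by rewrite /conjg !gnorm.
  by apply: nLH; apply: memgV.
Qed.

Lemma join_subl H L : subgroup L -> H `<=` join H L.
Proof. by move=> gL x Hx; exists x; rewrite ?mulVg //; exact: memg1. Qed.

Lemma join_subr H L : subgroup H -> L `<=` join H L.
Proof. by move=> gL x Hx; exists 1; rewrite ?invg1 ?mul1g //; exact: memg1. Qed.

Lemma join_min H L K : subgroup K -> H `<=` K -> L `<=` K -> join H L `<=` K.
Proof.
move=> gK HK LK x [h Hh Lx]; rewrite -(mulVKg h x).
by apply: memgM => //; [apply: HK|apply: LK].
Qed.

Lemma cyclicP g x : generated [set g] x -> exists n, x = g ^+ n \/ x = g ^- n.
Proof.
have gP : subgroup [set x | exists n, x = g ^+ n \/ x = g ^- n].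
  have XV m n : exists k, g ^+ m * g ^- n = g ^+ k \/ g ^+ m * g ^- n = g ^- k.
    have [mn|/ltnW mn] := leqP n m.
      by exists (m - n)%N; left; rewrite expgnFr.
    by exists (n - m)%N; right; rewrite expgnFr // invgM invgK.
  have cX m n : g ^- m * g ^+ n = g ^+ n * g ^- m.
    by apply/commute_sym/commuteV/commuteX2/commute_refl.
  split=> [|_ _ [m [->|->]] [n [->|->]]|_ [m [->|->]]] /=.
  - by exists 0%N; left.
  - by exists (m + n)%N; left; rewrite expgnDr.
  - exact: XV.
  - by rewrite cX; apply: XV.
  - by exists (n + m)%N; right; rewrite expgnDr invgM.
  - by exists m; right.
  - by exists m; left; rewrite invgK.
by apply: (generated_sub gP) => y ->; exists 1%N; left.
Qed.

Lemma fg_subgroup_ind (P : set G -> Prop) :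
  P [set 1] ->
  (forall g S, finite_set S -> P (generated S) -> P (generated (g |` S))) ->
  forall H, fg_subgroup H -> P H.
Proof.
move=> P1 PS H [S /finite_seqP[s ->] <-] {H S}.
elim: s => [|g s IH].
  suff -> : generated [set` [::]] = [set (1 : G)] by [].
  apply/seteqP; split.
    by apply: (generated_sub subgroup1) => x; rewrite /= in_nil.
  by move=> x ->; apply: memg1 (generated_subgroup _).
suff -> : [set` g :: s] = g |` [set` s] by apply: PS => //; apply: finite_seq.
apply/seteqP; split=> x /=; rewrite inE; first by case/predU1P; [left|right].
by case=> [->|->]; rewrite ?eqxx ?orbT.
Qed.

End Subgroups.

Arguments subgroup1 {G}.
Arguments sub_generated {G S} [t] _.
Arguments generated_mono {G S T} _ [t] _.

(** * Quotient groups *)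

Notation group_morphism G Q := (UMagmaMorphism.type G Q).

Section Quotient.
Variables (G : groupType) (K : set G).
Hypothesis nK : normal K.

Definition coset_rel (x y : G) : bool := `[< K (x^-1 * y) >].

Lemma coset_equiv : equiv_class_of coset_rel.
Proof.
have [gK _] := nK; split=> [x|x y|y x z].
- by apply/asboolP; rewrite mulVg; apply: memg1.
- by apply/asboolP/asboolP => /(memgV gK); rewrite invgM invgK.
- move=> /asboolP xy /asboolP yz; apply/asboolP.
  by rewrite -(mulVKg y z) mulgA; apply: memgM.
Qed.

Canonical coset_equiv_rel := EquivRelPack coset_equiv.

Definition coset_type := {eq_quot coset_equiv_rel}.
HB.instance Definition _ := Choice.on coset_type.

Definition coset_pi (x : G) : coset_type := \pi_{eq_quot coset_equiv_rel} x.

Lemma coset_eqP x y : coset_pi x = coset_pi y <-> K (x^-1 * y).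
Proof.
split=> [/eqP|Kxy]; last by apply/eqP; rewrite eqmodE; apply/asboolP.
by rewrite eqmodE => /asboolP.
Qed.

Lemma coset_piK (u : coset_type) : coset_pi (repr u) = u.
Proof. exact: reprK. Qed.

Definition coset_one := coset_pi 1.
Definition coset_mul (u v : coset_type) := coset_pi (repr u * repr v).
Definition coset_inv (u : coset_type) := coset_pi (repr u)^-1.

Lemma coset_piM x y : coset_mul (coset_pi x) (coset_pi y) = coset_pi (x * y).
Proof.
have [gK cK] := nK; apply/coset_eqP.
have /coset_eqP Kx := coset_piK (coset_pi x).
have /coset_eqP Ky := coset_piK (coset_pi y).
set x' := repr _ in Kx *; set y' := repr _ in Ky *.
have -> : (x' * y')^-1 * (x * y) = (x'^-1 * x) ^ y' * (y'^-1 * y).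
  by rewrite /conjg !gnorm.
by apply: memgM => //; apply: cK.
Qed.

Lemma coset_piV x : coset_inv (coset_pi x) = coset_pi x^-1.
Proof.
have [gK cK] := nK; apply/coset_eqP.
have /coset_eqP Kx := coset_piK (coset_pi x).
set x' := repr _ in Kx *.
have -> : x'^-1^-1 * x^-1 = ((x'^-1 * x)^-1) ^ x'^-1 by rewrite /conjg !gnorm.
by apply: cK; apply: memgV.
Qed.

Lemma coset_mulA : associative coset_mul.
Proof.
move=> u v w; rewrite -(coset_piK u) -(coset_piK v) -(coset_piK w).
by rewrite !coset_piM mulgA.
Qed.

Lemma coset_mul1g : left_id coset_one coset_mul.
Proof. by move=> u; rewrite -(coset_piK u) coset_piM mul1g. Qed.

Lemma coset_mulg1 : right_id coset_one coset_mul.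
Proof. by move=> u; rewrite -(coset_piK u) coset_piM mulg1. Qed.

Lemma coset_mulVg : left_inverse coset_one coset_inv coset_mul.
Proof. by move=> u; rewrite -(coset_piK u) coset_piV coset_piM mulVg. Qed.

Lemma coset_mulgV : right_inverse coset_one coset_inv coset_mul.
Proof. by move=> u; rewrite -(coset_piK u) coset_piV coset_piM mulgV. Qed.

HB.instance Definition _ := isGroup.Build coset_type
  coset_mulA coset_mul1g coset_mulg1 coset_mulVg coset_mulgV.

Lemma coset_piF : {morph coset_pi : x y / x / y}.
Proof. by move=> x y; rewrite -coset_piM -coset_piV. Qed.

HB.instance Definition _ := isGroupMorphism.Build G coset_type coset_pi coset_piF.

(** The quotient is used only through a surjective morphism with kernel [K]. *)
Lemma quotient_exists : exists (Q : groupType) (f : group_morphism G Q),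
  (forall q, exists x, f x = q) /\ (forall x, f x = 1 <-> K x).
Proof.
exists coset_type, coset_pi; split=> [q|x].
  by exists (repr q); apply: coset_piK.
have -> : (1 : coset_type) = coset_pi 1 by [].
split=> [/esym/coset_eqP|Kx]; first by rewrite invg1 mul1g.
by apply/esym/coset_eqP; rewrite invg1 mul1g.
Qed.

End Quotient.

(** * Polycyclic groups *)

Section Polycyclic.
Variable G : groupType.
Implicit Types (A B D H K L S T U : set G) (a g h x y z : G).

Notation cyclic g := (generated [set g]).

(** Invariance under [g] alone would not do: for infinite [L] it does not imply
    invariance under [g^-1]. *)
Definition stable g L : Prop := forall x, L x -> L (x ^ g) /\ L (x ^ g^-1).

Lemma cyclic_id g : cyclic g g.
Proof. exact: sub_generated. Qed.

Arguments cyclic_id g : clear implicits.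

Lemma cyclicX g n : cyclic g (g ^+ n).
Proof. exact: (memgX (generated_subgroup _) _ (cyclic_id g)). Qed.

Arguments cyclicX g n : clear implicits.

Lemma stable_cyclic g L h x : stable g L -> cyclic g h -> L x -> L (x ^ h).
Proof.
move=> sL /cyclicP[n hE] Lx.
suff [Lg Lv] : L (x ^ (g ^+ n)) /\ L (x ^ (g ^- n)) by case: hE => ->.
elim: n {hE} => [|n [IH1 IH2]]; first by rewrite expg0 invg1 conjg1.
rewrite {1}expgSr expgS invgM !conjgM.
by split; [apply: (sL _ IH1).1|apply: (sL _ IH2).2].
Qed.

Lemma stable_generated g S :
  (forall s, S s -> generated S (s ^ g) /\ generated S (s ^ g^-1)) ->
  stable g (generated S).
Proof.
move=> sS x; have gS := generated_subgroup S.
suff gP : subgroup [set y | generated S (y ^ g) /\ generated S (y ^ g^-1)].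
  by move=> Sx; apply: (generated_sub gP _ Sx).
split=> [|y z [yg yV] [zg zV]|y [yg yV]] /=.
- by rewrite !conj1g; split; apply: (memg1 gS).
- by rewrite !conjMg; split; apply: (memgM gS).
- by rewrite !conjVg; split; apply: (memgV gS).
Qed.

Lemma join_cyclic_subgroup g L :
  subgroup L -> stable g L -> subgroup (join (cyclic g) L).
Proof.
move=> gL sL; apply: join_subgroup gL _; first exact: generated_subgroup.
by move=> h x; apply: stable_cyclic.
Qed.

Definition noetherian H : Prop :=
  forall U, subgroup U -> U `<=` H -> fg_subgroup U.

(** Series from [A] up to a subgroup of the ambient group with cyclic factors;
    [A] itself is arbitrary, so that such series can be lifted from quotients
    and concatenated. *)
Inductive polycyclic_over A : set G -> Prop :=
| polycyclic_refl : polycyclic_over A A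
| polycyclic_step g L : polycyclic_over A L -> stable g L ->
    polycyclic_over A (join (cyclic g) L).

Lemma polycyclic_subgroup A H :
  subgroup A -> polycyclic_over A H -> subgroup H /\ A `<=` H.
Proof.
move=> gA; elim=> [|g L _ [gL AL] sL]; first by split.
split; first exact: join_cyclic_subgroup.
by move=> x /AL Lx; apply: join_subr => //; apply: generated_subgroup.
Qed.

Lemma polycyclic_trans B A H :
  polycyclic_over B A -> polycyclic_over A H -> polycyclic_over B H.
Proof. by move=> pA; elim=> // g L _ pL sL; apply: polycyclic_step. Qed.

(** The exponents [n] for which [g ^+ n] meets [U] modulo [L] are the multiples
    of the least positive one, if any; [u] realizes this least exponent. Since
    exponents are natural numbers, negative ones are reached through [v^-1]. *)
Lemma cyclic_mod_subgroup g L U :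
  subgroup L -> stable g L -> subgroup U -> U `<=` join (cyclic g) L ->
  exists2 u, U u & forall v, U v ->
    exists q, L ((u ^+ q)^-1 * v) \/ L ((u ^+ q)^-1 * v^-1).
Proof.
move=> gL sL gU UgL.
pose P n := exists2 u, U u & L ((g ^+ n)^-1 * u).
have UP v : U v -> exists n, exists2 w, w = v \/ w = v^-1 & L ((g ^+ n)^-1 * w).
  move=> /UgL[c /cyclicP[n [->|->]] Lv]; exists n; first by exists v => //; left.
  exists v^-1; first by right.
  have -> : (g ^+ n)^-1 * v^-1 = (((g ^- n)^-1 * v) ^ (g ^+ n))^-1.
    by rewrite /conjg !gnorm.
  by apply/(memgV gL)/(stable_cyclic sL) => //; apply: cyclicX.
have [[d0 Pd0]|noP] := pselect (exists n, P n.+1); last first.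
  exists 1; first exact: memg1.
  move=> v Uv; exists 0%N; rewrite expg0 invg1 !mul1g.
  have [[|n] [w wv Lw]] := UP v Uv.
    by rewrite expg0 invg1 mul1g in Lw; case: wv => <-; [left|right].
  case: noP; exists n; exists w => //.
  by case: wv => ->; [|apply: memgV].
have [d /asboolP[u Uu Lu] dmin] : {d | `[< P d.+1 >] &
    forall n, `[< P n.+1 >] -> d <= n}%N.
  have exP : exists n, `[< P n.+1 >] by exists d0; apply/asboolP.
  by case: (ex_minnP exP) => d ? ?; exists d.
exists u => // v Uv.
suff key n w : U w -> L ((g ^+ n)^-1 * w) -> exists q, L ((u ^+ q)^-1 * w).
  have [n [w wv Lw]] := UP v Uv.
  have Uw : U w by case: wv => ->; [|apply: memgV].
  have [q Lq] := key n w Uw Lw.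
  by exists q; case: wv Lq => -> ?; [left|right].
have [N] := ubnP n; elim: N n w => // N IH [|n] w nN Uw Lw.
  by exists 0%N; rewrite expg0 in Lw *.
have dn : (d <= n)%N by apply: dmin; apply/asboolP; exists w.
have [||| q Lq] := IH (n - d)%N (u^-1 * w).
- by rewrite ltnS in nN; apply: leq_ltn_trans nN; apply: leq_subr.
- by apply: memgM => //; apply: memgV.
- have -> : (g ^+ (n - d))^-1 * (u^-1 * w) =
      (((g ^+ d.+1)^-1 * u)^-1) ^ (g ^+ (n - d)) * ((g ^+ n.+1)^-1 * w).
    have -> : n.+1 = (d.+1 + (n - d))%N by rewrite addSn subnKC.
    by rewrite expgnDr /conjg !gnorm.
  apply: (memgM gL) => //; apply: (stable_cyclic sL) (memgV gL Lu).
  exact: cyclicX.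
- by exists q.+1; rewrite expgS invgM -mulgA.
Qed.

Lemma fg_subgroup1 : fg_subgroup [set (1 : G)].
Proof.
exists set0; first exact: finite_set0.
apply/seteqP; split; first by apply: (generated_sub subgroup1); apply: sub0set.
by move=> x ->; apply: memg1 (generated_subgroup _).
Qed.

Lemma noetherian1 : noetherian [set 1].
Proof.
move=> U gU U1; suff -> : U = [set 1] by apply: fg_subgroup1.
by apply/seteqP; split=> // x ->; apply: memg1.
Qed.

(** A subgroup [U] of the extension is generated by the intersection of [U]
    with [L], together with one element generating the image of [U] in the
    cyclic factor. *)
Lemma noetherian_step g L : subgroup L -> stable g L -> noetherian L ->
  noetherian (join (cyclic g) L).
Proof.
move=> gL sL nL U gU UgL; have [u Uu uP] := cyclic_mod_subgroup gL sL gU UgL.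
have [S fS SE] : fg_subgroup (U `&` L).
  by apply: nL; [apply: subgroupI|apply: subIsetr].
have gT := generated_subgroup (u |` S).
exists (u |` S); first by rewrite finite_setU; split=> //; apply: finite_set1.
apply/seteqP; split.
  apply: (generated_sub gU) => s [->//|Ss].
  by have [] : (U `&` L) s by rewrite -SE; apply: sub_generated.
have Tu q : generated (u |` S) (u ^+ q).
  by apply: (memgX gT); apply: sub_generated; left.
have TUL w : U w -> L w -> generated (u |` S) w.
  move=> Uw Lw; have : generated S w by rewrite SE.
  by apply: generated_mono => y; right.
move=> v Uv; have [q [Lq|Lq]] := uP v Uv.
  apply: (memgMl gT (memgV gT (Tu q))); apply: TUL => //.
  by apply: (memgM gU) => //; apply: (memgV gU); apply: memgX.
rewrite -(invgK v); apply: (memgV gT).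
apply: (memgMl gT (memgV gT (Tu q))); apply: TUL => //.
by apply: (memgM gU); [apply: (memgV gU); apply: memgX|apply: memgV].
Qed.

Lemma polycyclic_noetherian A H :
  subgroup A -> noetherian A -> polycyclic_over A H -> noetherian H.
Proof.
move=> gA nA; elim=> // g L pL nL sL; apply: noetherian_step => //.
by have [] := polycyclic_subgroup gA pL.
Qed.

Lemma join1 H : join H [set 1] = H.
Proof.
apply/seteqP; split=> [x [h Hh /= hx]|]; last exact: join_subl subgroup1.
by rewrite -(mulVKg h x) hx mulg1.
Qed.

Lemma noetherian_cyclic g : noetherian (cyclic g).
Proof.
rewrite -[cyclic g]join1; apply: noetherian_step noetherian1.
  exact: subgroup1.
by move=> x ->; rewrite !conj1g.
Qed.

Lemma abelian_cyclic g : abelian (cyclic g).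
Proof.
move=> x y /cyclicP[m xE] /cyclicP[n yE].
have gg : commute (g ^+ m) (g ^+ n) by apply/commuteX2/commute_refl.
case: xE yE => -> [] ->.
- exact: gg.
- exact: commuteV.
- by apply/commute_sym/commuteV/commute_sym.
- by apply/commuteV/commute_sym/commuteV/commute_sym.
Qed.

Lemma fg_abelian_polycyclic A :
  fg_subgroup A -> abelian A -> polycyclic_over [set 1] A.
Proof.
elim/fg_subgroup_ind => {A} [_|g S fS IH cA]; first exact: polycyclic_refl.
have sS : generated S `<=` generated (g |` S).
  by apply: generated_mono => y; right.
have gg : generated (g |` S) g by apply: sub_generated; left.
have cgS x : generated S x -> x ^ g = x.
  by move=> /sS Sx; rewrite /conjg (cA x g) // mulKg.
have pS : polycyclic_over [set 1] (generated S).
  by apply: IH => x y /sS Sx /sS Sy; apply: cA.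
suff -> : generated (g |` S) = join (cyclic g) (generated S).
  apply: polycyclic_step => // x Sx; rewrite cgS //; split=> //.
  by rewrite -{1}(cgS x Sx) conjgK.
apply/seteqP; split.
  apply: generated_sub.
    apply: join_cyclic_subgroup; first exact: generated_subgroup.
    by move=> x Sx; rewrite cgS //; split=> //; rewrite -{1}(cgS x Sx) conjgK.
  move=> s [->|Ss]; first exact: (join_subl (generated_subgroup _)) (cyclic_id g).
  by apply: (join_subr (generated_subgroup _)); apply: sub_generated.
apply: join_min (generated_subgroup _) _ sS.
by apply: (generated_sub (generated_subgroup _)) => _ ->.
Qed.

(** Every [h] in [L] lies in a finitely generated subgroup of [L] invariant
    under conjugation by [g] and [g^-1]. *)
Definition restrained g L : Prop := forall h, L h -> exists S,
  [/\ finite_set S, S `<=` L, generated S h & stable g (generated S)].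

(** Write each generator of the extension as a power of [g] times an element of
    [L]. The [g]-invariant subgroups provided by [restrained] for these elements
    of [L], together with the intersection of [L] and the cyclic group of [g],
    generate a finitely generated [g]-invariant subgroup M of [L]; every
    generator is in <g> M, hence so is [L], which is therefore equal to M. *)
Lemma fg_cyclic_extension g L : subgroup L -> stable g L -> restrained g L ->
  fg_subgroup (join (cyclic g) L) -> fg_subgroup L.
Proof.
move=> gL sL rL [S0 fS0 S0E].
have /choice[T TP] : forall s, exists T, S0 s -> [/\ finite_set T, T `<=` L,
    stable g (generated T) & join (cyclic g) (generated T) s].
  move=> s; have [Ss|] := pselect (S0 s); last by exists set0.
  have : join (cyclic g) L s by rewrite -S0E; apply: sub_generated.
  move=> [c gc Lcs]; have [T [fT TL Tcs sT]] := rL _ Lcs.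
  by exists T => _; split=> //; exists c.
pose S1 := \bigcup_(s in S0) T s.
have [S2 fS2 S2E] : fg_subgroup (cyclic g `&` L).
  apply: (@noetherian_cyclic g); last exact: subIsetl.
  by apply: subgroupI => //; apply: generated_subgroup.
have S2P x : S2 x -> cyclic g x /\ L x.
  by move=> S2x; have : (cyclic g `&` L) x by rewrite -S2E; apply: sub_generated.
pose M := generated (S1 `|` S2).
have gM : subgroup M := generated_subgroup _.
have T1M s : S0 s -> generated (T s) `<=` M.
  by move=> Ss; apply: generated_mono => x Tx; left; exists s.
have cM : stable g M.
  apply: stable_generated => x [[s Ss Tx]|S2x].
    have [_ _ sT _] := TP s Ss; have [] := sT x (sub_generated Tx).
    by split; apply: T1M Ss _ _.
  have [gx _] := S2P x S2x.
  have xg : x ^ g = x by rewrite /conjg (abelian_cyclic gx (cyclic_id g)) mulKg.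
  have xV : x ^ g^-1 = x by rewrite -{1}xg conjgK.
  by rewrite xg xV; split; apply: sub_generated; right.
have ML : M `<=` L.
  apply: (generated_sub gL) => x [[s Ss Tx]|/S2P[]//].
  by have [_ + _ _] := TP s Ss; apply.
have HJ : join (cyclic g) L `<=` join (cyclic g) M.
  rewrite -S0E; apply: (generated_sub (join_cyclic_subgroup gM cM)) => s Ss.
  by have [_ _ _ [c gc Tc]] := TP s Ss; exists c => //; apply: T1M Tc.
exists (S1 `|` S2).
  rewrite finite_setU; split=> //; apply: bigcup_finite => // s Ss.
  by have [] := TP s Ss.
apply/seteqP; split=> // l Ll.
have [c gc Mc] := HJ l (join_subr (generated_subgroup _) Ll).
rewrite -(mulVKg c l); apply: (memgM gM) => //.
have Lc : L c.
  by rewrite -(invgK c); apply/(memgV gL)/(memgMr gL Ll)/ML.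
have : generated S2 c by rewrite S2E.
by apply: generated_mono => x; right.
Qed.

Lemma fg_polycyclic_base A H : subgroup A -> polycyclic_over A H ->
  (forall g L, subgroup L -> A `<=` L -> stable g L -> restrained g L) ->
  fg_subgroup H -> fg_subgroup A.
Proof.
move=> gA pH rA; elim: pH => // g L pL IH sL fH; apply: IH.
have [gL AL] := polycyclic_subgroup gA pL.
by apply: fg_cyclic_extension fH => //; apply: rA.
Qed.

End Polycyclic.

Arguments cyclic_id {G} g.
Arguments cyclicX {G} g n.

Notation cyclic g := (generated [set g]).

Lemma preimage_polycyclic (G Q : groupType) (f : group_morphism G Q) A H :
  (forall q, exists x, f x = q) -> polycyclic_over A H ->
  polycyclic_over (f @^-1` A) (f @^-1` H).
Proof.
move=> surj; elim=> [|q L pL IH sL]; first exact: polycyclic_refl.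
have [g gq] := surj q.
suff -> : f @^-1` (join (cyclic q) L) = join (cyclic g) (f @^-1` L).
  by apply: polycyclic_step => // x /sL; rewrite /= !gmulfJ gmulfV gq.
have gg := cyclicX g; have qq := cyclicX q.
apply/seteqP; split=> x /=; last first.
  move=> [c /cyclicP[n [->|->]] /=]; rewrite gmulfM !gmulfV gmulfXn gq => Lx.
    by exists (q ^+ n).
  by exists (q ^- n) => //; apply: memgV (generated_subgroup _) _ _.
move=> [c /cyclicP[n [->|->]] /= Lx]; [exists (g ^+ n)|exists (g ^- n)] => //=.
- by rewrite gmulfM !gmulfV gmulfXn gq.
- exact: (memgV (generated_subgroup _)).
- by rewrite gmulfM !gmulfV gmulfXn gq.
Qed.

(** * The Engel condition on sequences *)

(** The indices are distinct, not necessarily the terms: if [x i = x j] the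
    condition holds with [k = 1]. The value [k = 0] stands for [x i = 1] or
    [x j = 1], when all iterated commutators of that term are 1. *)
Definition Engel_sequences (G : groupType) : Prop :=
  forall x : nat -> G, exists i j k, (i < j)%N /\
    (iter_comm (x i) k (x j) = 1 \/ iter_comm (x j) k (x i) = 1).

Section IterComm.
Variable G : groupType.
Implicit Types (A H K : set G) (a b g x y z : G).

Lemma iter_commS x k y : iter_comm x k.+1 y = [~ iter_comm x k y, y].
Proof. by []. Qed.

Lemma iter_commSr x k y : iter_comm x k.+1 y = iter_comm [~ x, y] k y.
Proof. exact: iterSr. Qed.

Lemma iter_commD x k l y : iter_comm x (k + l) y = iter_comm (iter_comm x l y) k y.
Proof. exact: iterD. Qed.

Lemma iter_comm1 k y : iter_comm 1 k y = 1 :> G.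
Proof. by elim: k => // k IH; rewrite iter_commS IH comm1g. Qed.

(** The terms of a sequence that violates [Engel_sequences] are distinct and
    pairwise satisfy the adjacency condition. They are vertices: if
    x_i were left Engel, some [x_(i+1),_k x_i] would be 1. *)
Lemma no_infinite_clique_sequences : ~ has_infinite_clique (Engel_graph G) ->
  Engel_sequences G.
Proof.
move=> noC x; apply: contrapT => noE; apply: noC.
have xE i j k : i <> j -> iter_comm (x i) k (x j) <> 1.
  move=> ij E; apply: noE; have [lij|lji|//] := ltngtP i j.
    by exists i, j, k; split=> //; left.
  by exists j, i, k; split=> //; right.
have xI : injective x.
  move=> i j xij; apply: contrapT => ij; apply: (xE i j 1%N ij).
  by rewrite xij; apply: commgg.
have xV i : Engel_vertices (x i).
  split=> // Lx; have [k [_]] := Lx (x i.+1).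
  exact: xE (nesym (n_Sn i)).
exists (range x); split; last first.
  move=> /(finite_preimage (in2W xI)); rewrite preimage_range.
  exact: infinite_nat.
split; first by move=> _ [i _ <-]; apply: xV.
move=> _ _ [i _ <-] [j _ <-] xij; have ij : i <> j by move=> ij; rewrite ij in xij.
by split=> // k _; split; apply: xE => //; apply/nesym.
Qed.

Section AbelianNormal.
Variable A : set G.
Hypotheses (nA : normal A) (cA : abelian A).

Let gA : subgroup A := nA.1.
Let jA a y : A a -> A (a ^ y) := @nA.2 a y.

Lemma normalR a y : A a -> A [~ a, y].
Proof. by move=> Aa; apply: (memgM gA); [apply: memgV|apply: jA]. Qed.

Lemma normal_iter_comm a k y : A a -> A (iter_comm a k y).
Proof. by move=> Aa; elim: k => // k IH; apply: normalR. Qed.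

Lemma abelian_commM a b y : A a -> A b -> [~ a * b, y] = [~ a, y] * [~ b, y].
Proof.
move=> Aa Ab; have -> : [~ a * b, y] = [~ a, y] ^ b * [~ b, y].
  by rewrite /commg /conjg !gnorm.
by rewrite [_ ^ b]/conjg (cA (normalR y Aa) Ab) mulKg.
Qed.

Lemma iter_commM a b k y : A a -> A b ->
  iter_comm (a * b) k y = iter_comm a k y * iter_comm b k y.
Proof.
move=> Aa Ab; elim: k => // k IH.
by rewrite !iter_commS IH abelian_commM //; apply: normal_iter_comm.
Qed.

Lemma iter_commV a k y : A a -> iter_comm a^-1 k y = (iter_comm a k y)^-1.
Proof.
move=> Aa; apply: (mulgI (iter_comm a k y)).
by rewrite -iter_commM ?mulgV ?iter_comm1 //; apply: memgV.
Qed.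

Lemma iter_commX a n k y : A a -> iter_comm (a ^+ n) k y = iter_comm a k y ^+ n.
Proof.
move=> Aa; elim: n => [|n IH]; first by rewrite !expg0 iter_comm1.
by rewrite !expgS iter_commM ?IH //; apply: (memgX gA).
Qed.

(** With u = y b and c = b^-1 a, the left-hand commutators are those of u c with
    u, and [u c, u] = [c, u]; on [A], commutation with u = y b and with y agree
    because [b] centralizes [A]. *)
Lemma iter_comm_mulr a b k y : A a -> A b ->
  iter_comm (y * a) k.+1 (y * b) = iter_comm (b^-1 * a) k.+1 y.
Proof.
move=> Aa Ab; have dE d : A d -> [~ d, y * b] = [~ d, y].
  move=> Ad; rewrite /commg conjgM; congr (_ * _).
  by rewrite /conjg (cA (jA y Ad) Ab) mulKg.
rewrite !iter_commSr.
have -> : [~ y * a, y * b] = [~ b^-1 * a, y * b].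
  by rewrite /commg /conjg !gnorm.
have Aba : A (b^-1 * a) by apply: (memgM gA) => //; apply: memgV.
rewrite dE //; elim: k => // k IH; rewrite !iter_commS IH dE //.
exact/normal_iter_comm/normalR.
Qed.

Lemma Engel_abelian_sequence (a : nat -> G) y : Engel_sequences G ->
  (forall i, A (a i)) -> exists i j k, (i < j)%N /\
  iter_comm ((a i)^-1 * a j) k y = 1.
Proof.
move=> EG Aa; have [i [j [k [ij E]]]] := EG (fun i => y * a i).
exists i, j, k.+1; split=> //.
have Aij : A ((a i)^-1 * a j) by apply: (memgM gA); [apply: memgV|].
case: E => E; last by rewrite -iter_comm_mulr // iter_commS E comm1g.
rewrite -[_ * a j]invgK invgM invgK iter_commV; last first.
  by apply: (memgM gA) => //; apply: memgV.
by rewrite -iter_comm_mulr // iter_commS E comm1g invg1.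
Qed.

(** The elements [c,_i g], i < k, generate a [g]-invariant subgroup since
    [c,_i g]^g = [c,_i g] [c,_(i+1) g]. *)
Lemma Engel_restrained k c g : A c -> iter_comm c k g = 1 -> exists S,
  [/\ finite_set S, S `<=` A, generated S c & stable g (generated S)].
Proof.
elim: k c => [|k IH] c Ac.
  move=> /= ->; exists set0; split=> //.
    exact: (memg1 (generated_subgroup _)).
  by apply: stable_generated.
rewrite iter_commSr => /IH[|S [fS SA Sc sS]]; first exact: normalR.
have gS' := generated_subgroup (c |` S).
have SS' : generated S `<=` generated (c |` S).
  by apply: generated_mono => x; right.
have S'c : generated (c |` S) c by apply: sub_generated; left.
exists (c |` S); split=> //.
- by rewrite finite_setU; split=> //; apply: finite_set1.
- by move=> x [->|/SA].
- apply: stable_generated => s [->|Ss]; last first.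
    by have [] := sS s (sub_generated Ss); split; apply: SS'.
  split.
    have -> : c ^ g = c * [~ c, g] by rewrite mulVKg.
    by apply: (memgM gS') => //; apply: SS'.
  have -> : c ^ g^-1 = c * ([~ c, g] ^ g^-1)^-1 by rewrite /commg /conjg !gnorm.
  apply: (memgM gS') => //; apply: (memgV gS'); apply: SS'.
  by have [] := sS _ Sc.
Qed.

(** For suitable b = a^(g^i), m > 0 and c = b^-1 b^(g^m), some [c,_k g] is 1.
    The conjugates b^(g^l) for l < m generate, together with a [g]-invariant
    subgroup containing [c], a [g]-invariant subgroup, as b^(g^m) = b c. *)
Lemma abelian_restrained g : Engel_sequences G -> restrained g A.
Proof.
move=> EG a Aa.
have [i [j [k [ij E]]]] :=
  Engel_abelian_sequence g EG (fun i => jA (g ^+ i) Aa).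
pose b := a ^ (g ^+ i); have Ab : A b by apply: jA.
pose m := (j - i)%N; have m_gt0 : (0 < m)%N by rewrite subn_gt0.
pose c := b^-1 * b ^ (g ^+ m).
have Ac : A c by apply: (memgM gA); [apply: memgV|apply: jA].
have {}E : iter_comm c k g = 1.
  by rewrite /c /b -conjgM -expgnDr subnKC // ltnW.
have [S [fS SA Sc sS]] := Engel_restrained Ac E.
pose S' := S `|` [set b ^ (g ^+ l) | l in `I_m].
have gS' := generated_subgroup S'.
have SS' : generated S `<=` generated S' by apply: generated_mono => x; left.
have bS' l : (l < m)%N -> generated S' (b ^ (g ^+ l)).
  by move=> lm; apply: sub_generated; right; exists l.
have b0 : generated S' b by have := bS' 0%N m_gt0; rewrite expg0 conjg1.
have bm : b ^ (g ^+ m) = b * c by rewrite mulVKg.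
have sS' : stable g (generated S').
  apply: stable_generated => s [Ss|[l /= lm <-]].
    by have [] := sS s (sub_generated Ss); split; apply: SS'.
  split.
    rewrite -conjgM -expgSr; move: lm; rewrite leq_eqVlt => /predU1P[->|/bS'//].
    by rewrite bm; apply: (memgM gS') => //; apply: SS'.
  case: l lm => [_|l lm]; last first.
    by rewrite expgSr conjgM conjgK; apply: bS'; apply: ltnW.
  have -> : (b ^ (g ^+ 0)) ^ g^-1 = b ^ (g ^+ m.-1) * (c ^ g^-1)^-1.
    have -> : b ^ (g ^+ m.-1) = (b * c) ^ g^-1.
      by rewrite -bm -{2}(prednK m_gt0) expgSr conjgM conjgK.
    by rewrite expg0 conjg1 [(b * c) ^ _]conjMg mulgK.
  apply: (memgM gS'); first by apply: bS'; rewrite prednK.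
  by apply: (memgV gS'); apply: SS'; have [] := sS _ Sc.
exists S'; split=> //.
- by rewrite finite_setU; split=> //; apply: finite_image; apply: finite_II.
- by move=> x [/SA//|[l _ <-]]; apply: jA.
- rewrite -(conjgK (g ^+ i) a); apply: (stable_cyclic sS') => //.
  exact: (memgV (generated_subgroup _) (cyclicX g i)).
Qed.

(** Let U be the smallest [g]-invariant subgroup containing [h]. Modulo [A] it
    is generated by finitely many of its elements s; the conjugates of these s
    by [g] and [g^-1] are products of these generators up to finitely many
    errors in [A], each of which lies in a finitely generated [g]-invariant
    subgroup of [A] by [abelian_restrained]. *)
Lemma restrained_over_abelian g L : Engel_sequences G -> subgroup L -> A `<=` L ->
  stable g L -> (forall U, subgroup U -> exists S, [/\ finite_set S, S `<=` U &
     forall u, U u -> exists2 w, generated S w & A (w^-1 * u)]) ->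
  restrained g L.
Proof.
move=> EG gL AL sL maxA h Lh.
pose U := generated [set h ^ c | c in cyclic g].
have gU : subgroup U := generated_subgroup _.
have sU : stable g U.
  have gg : cyclic g g^-1.
    by apply: (memgV (generated_subgroup _)); apply: cyclic_id.
  apply: stable_generated => _ [c gc <-]; rewrite -!conjgM.
  split; apply: sub_generated; [exists (c * g)|exists (c * g^-1)] => //.
    by apply: (memgM (generated_subgroup _)) => //; apply: cyclic_id.
  by apply: (memgM (generated_subgroup _)).
have Uh : U h.
  apply: sub_generated; exists 1; last by rewrite conjg1.
  exact: (memg1 (generated_subgroup _)).
have UL : U `<=` L.
  by apply: (generated_sub gL) => _ [c gc <-]; apply: (stable_cyclic sL).
have [S0 [fS0 S0U S0P]] := maxA U gU.
pose S1 := h |` S0.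
have S1U : S1 `<=` U by move=> s [->|/S0U].
have fS1 : finite_set S1 by rewrite finite_setU; split=> //; apply: finite_set1.
have /choice[T TP] : forall s, exists T, U s -> [/\ finite_set T, T `<=` A,
    stable g (generated T) &
    exists w a, [/\ generated S1 w, generated T a & s = w * a]].
  move=> s; have [Us|] := pselect (U s); last by exists set0.
  have [w Sw Aws] := S0P s Us.
  have [T [fT TA Ta sT]] := abelian_restrained g EG Aws.
  exists T => _; split=> //.
  exists w, (w^-1 * s); split=> //; last by rewrite mulVKg.
  by apply: generated_mono Sw => x; right.
(* generators of invariant subgroups of [A] that contain the errors *)
pose S2 := \bigcup_(s in S1) (T (s ^ g) `|` T (s ^ g^-1)).
pose S := S1 `|` S2.
have gS : subgroup (generated S) := generated_subgroup _.
have S1S : generated S1 `<=` generated S by apply: generated_mono => x; left.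
have S2A : S2 `<=` A.
  move=> x [s /S1U Us]; have [Ug Uv] := sU s Us.
  by case=> Tx; [have [_ + _ _] := TP _ Ug|have [_ + _ _] := TP _ Uv]; apply.
exists S; split.
- rewrite finite_setU; split=> //; apply: bigcup_finite => // s Ss.
  have [Ug Uv] := sU s (S1U _ Ss).
  by rewrite finite_setU; split; [have [] := TP _ Ug|have [] := TP _ Uv].
- by move=> x [/S1U/UL|/S2A/AL].
- by apply: sub_generated; left; left.
apply: stable_generated => s [Ss|[s' Ss' Ts]].
  have [Ug Uv] := sU s (S1U _ Ss).
  have [_ _ _ [w [a [Sw Ta ->]]]] := TP _ Ug.
  have [_ _ _ [w' [a' [Sw' Ta' ->]]]] := TP _ Uv.
  split; apply: (memgM gS); try exact: S1S.
    by apply: generated_mono Ta => x Tx; right; exists s => //; left.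
  by apply: generated_mono Ta' => x Tx; right; exists s => //; right.
have [Ug Uv] := sU s' (S1U _ Ss').
have [x [Tx sTx TS]] : exists x,
    [/\ T x s, stable g (generated (T x)) & T x `<=` S].
  case: Ts => Ts; [exists (s' ^ g)|exists (s' ^ g^-1)]; split=> //.
  - by have [] := TP _ Ug.
  - by move=> y Ty; right; exists s' => //; left.
  - by have [] := TP _ Uv.
  - by move=> y Ty; right; exists s' => //; right.
by have [] := sTx s (sub_generated Tx); split; apply: (generated_mono TS).
Qed.

End AbelianNormal.
End IterComm.

(** * Soluble groups with the Engel condition are polycyclic *)

Section Surjection.
Variables (G Q : groupType) (f : group_morphism G Q).
Hypothesis f_surj : forall q, exists x, f x = q.

Lemma preimage_subgroup U : subgroup U -> subgroup (f @^-1` U).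
Proof.
move=> gU; split=> [|x y|x] /=; first by rewrite gmulf1; apply: memg1.
  by rewrite gmulfM; apply: (memgM gU).
by rewrite gmulfV; apply: (memgV gU).
Qed.

Lemma image_subgroup H : subgroup H -> subgroup (f @` H).
Proof.
move=> gH; split=> [|_ _ [x Hx <-] [y Hy <-]|_ [x Hx <-]].
- by exists 1; [apply: memg1|apply: gmulf1].
- by exists (x * y); [apply: (memgM gH)|apply: gmulfM].
- by exists x^-1; [apply: (memgV gH)|apply: gmulfV].
Qed.

Lemma image_generated S : f @` generated S = generated (f @` S).
Proof.
apply/seteqP; split.
  move=> _ [x Sx <-]; move: x Sx.
  apply: (generated_sub (preimage_subgroup (generated_subgroup _))) => x Sx /=.
  by apply: sub_generated; exists x.
apply: (generated_sub (image_subgroup (generated_subgroup _))).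
by move=> _ [x Sx <-]; exists x => //; apply: sub_generated.
Qed.

Lemma image_setT : f @` setT = setT.
Proof. by apply/seteqP; split=> // q _; have [x <-] := f_surj q; exists x. Qed.

Lemma finitely_generated_quotient : finitely_generated G -> finitely_generated Q.
Proof.
move=> [S [fS SE]]; exists (f @` S); split; first exact: finite_image.
by rewrite -image_generated SE image_setT.
Qed.

Lemma image_derived_series n : derived_series Q n `<=` f @` derived_series G n.
Proof.
elim: n => [|n IH] /=; first by rewrite image_setT.
apply: (generated_sub (image_subgroup (generated_subgroup _))).
move=> _ [_ [_ [/IH[x Gx <-] /IH[y Gy <-] ->]]].
exists [~ x, y]; last exact: gmulfR.
by apply: sub_generated; exists x, y.
Qed.

Lemma morph_iter_comm x k y : f (iter_comm x k y) = iter_comm (f x) k (f y).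
Proof. by elim: k => // k IH; rewrite !iter_commS gmulfR IH. Qed.

Lemma Engel_sequences_quotient : Engel_sequences G -> Engel_sequences Q.
Proof.
move=> EG q; have /choice[x xq] : forall i, exists x, f x = q i by [].
have [i [j [k [ij E]]]] := EG x; exists i, j, k; split=> //.
by rewrite -!xq -!morph_iter_comm; case: E => ->; rewrite gmulf1; [left|right].
Qed.

End Surjection.

Section DerivedSeries.
Variable G : groupType.

Lemma derived_subgroup n : subgroup (derived_series G n).
Proof. by case: n => [|n]; [apply: subgroupT|apply: generated_subgroup]. Qed.

Lemma derivedR n x y : derived_series G n x -> derived_series G n y ->
  derived_series G n.+1 [~ x, y].
Proof. by move=> Dx Dy; apply: sub_generated; exists x, y. Qed.

Lemma derived_normal n : normal (derived_series G n).
Proof.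
split; first exact: derived_subgroup.
elim: n => //= n IH x g; move: x.
have gD := derived_subgroup n.+1.
suff gP : subgroup [set x | derived_series G n.+1 (x ^ g)].
  apply: (generated_sub gP) => _ [x [y [Dx Dy ->]]] /=.
  by rewrite conjRg; apply: derivedR; apply: IH.
split=> [|x y|x] /=; rewrite ?conj1g ?conjMg ?conjVg; first exact: memg1.
  exact: memgM.
exact: memgV.
Qed.

Lemma derived_abelian n :
  derived_series G n.+1 = [set 1] -> abelian (derived_series G n).
Proof.
move=> D1 x y Dx Dy; have : [set 1] [~ x, y] by rewrite -D1; apply: derivedR.
by move=> /eqP/commgP.
Qed.

End DerivedSeries.

Theorem Engel_soluble_polycyclic (G : groupType) n : finitely_generated G ->
  derived_series G n = [set 1] -> Engel_sequences G ->
  polycyclic_over [set 1] [set: G].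
Proof.
elim: n G => [|n IH] G fG DG EG; first by rewrite -DG; apply: polycyclic_refl.
pose A := derived_series G n.
have nA : normal A := derived_normal G n.
have cA : abelian A := derived_abelian DG.
have [Q [f [f_surj kerf]]] := quotient_exists nA.
have DQ : derived_series Q n = [set 1].
  apply/seteqP; split=> [q /(image_derived_series f_surj)[x Ax <-]|_ ->].
    by apply/kerf.
  exact: memg1 (derived_subgroup _ _).
have pQ : polycyclic_over [set 1] [set: Q].
  apply: IH => //; first exact: finitely_generated_quotient fG.
  exact: Engel_sequences_quotient EG.
have pG : polycyclic_over A setT.
  have -> : A = f @^-1` [set 1] by apply/seteqP; split=> x /kerf.
  by rewrite -(preimage_setT f); apply: preimage_polycyclic.
have nQ : noetherian [set: Q].
  by apply: polycyclic_noetherian pQ; [apply: subgroup1|apply: noetherian1].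
suff fA : fg_subgroup A.
  by apply: polycyclic_trans pG; apply: fg_abelian_polycyclic.
apply: (fg_polycyclic_base nA.1 pG); last by case: fG => S [fS SE]; exists S.
move=> g L gL AL sL; apply: (restrained_over_abelian nA cA EG gL AL sL) => U gU.
have [T fT TE] := nQ (f @` U) (image_subgroup f gU) (@subsetT _ _).
have /choice[s sP] : forall t, exists x, T t -> U x /\ f x = t.
  move=> t; have [Tt|] := pselect (T t); last by exists 1.
  have : (f @` U) t by rewrite -TE; apply: sub_generated.
  by case=> x Ux <-; exists x.
exists (s @` T); split; first exact: finite_image.
  by move=> _ [t /sP[Us _] <-].
move=> u Uu; have : (f @` U) (f u) by exists u.
have -> : f @` U = f @` generated (s @` T).
  rewrite image_generated -TE; congr generated; apply/seteqP; split=> t.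
    by move=> Tt; have [_ ft] := sP t Tt; exists (s t) => //; exists t.
  by case=> _ [t' Tt' <-] <-; have [_ ->] := sP t' Tt'.
case=> w Sw fw; exists w => //; apply/kerf.
by rewrite gmulfM gmulfV fw mulVg.
Qed.

(** * Right Engel elements in infinite noetherian soluble groups *)

Section InfiniteNoetherian.
Variable G : groupType.
Implicit Types (A B D H K S T U : set G) (a g h x y z : G).
Hypothesis nG : noetherian [set: G].

Let fgG H : subgroup H -> fg_subgroup H.
Proof. by move=> gH; apply: nG => //; apply: subsetT. Qed.

(** Elements [h], [h0] with [[~ h, s] = [~ h0, s]] differ by an element that
    commutes with [s]; as [[~ h, s]] takes finitely many values, one fibre is
    infinite, and a translate of it is inside the centralizer. *)
Lemma infinite_centralizer1 H s K : subgroup H -> infinite_set H ->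
  finite_set K -> (forall h, H h -> K [~ h, s]) ->
  infinite_set [set h | H h /\ [~ h, s] = 1].
Proof.
move=> gH iH fK HK fC; apply: iH.
pose fib c := [set h | H h /\ [~ h, s] = c].
have -> : H = \bigcup_(c in K) fib c.
  apply/seteqP; split=> [h Hh|h [c _ []]//].
  by exists [~ h, s]; [apply: HK|].
apply: bigcup_finite => // c _.
have [[h0 [Hh0 E0]]|nofib] := pselect (exists h, fib c h); last first.
  suff -> : fib c = set0 by apply: finite_set0.
  by apply/seteqP; split=> // h fh; case: nofib; exists h.
apply: (@sub_finite_set _ _
    ((fun h => h * h0) @` [set h | H h /\ [~ h, s] = 1])).
  move=> h [Hh E]; exists (h * h0^-1); last by rewrite mulgVK.
  split; first by apply: (memgM gH) => //; apply: memgV.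
  apply/eqP/commgP/commute_sym; rewrite -invgF; apply: commuteV.
  have : [~ h, s] = [~ h0, s] by rewrite E E0.
  rewrite !commgEr => /mulIg/(congr1 (fun x => (h * x * h0^-1)^-1)).
  by rewrite /conjg !gnorm /commute mulgA.
exact: finite_image.
Qed.

Definition centralizer H T : set G :=
  [set z | H z /\ forall x, T x -> [~ z, x] = 1].

Notation center H := (centralizer H H).

Lemma centralizer_subgroup H T : subgroup H -> subgroup (centralizer H T).
Proof.
move=> gH; split=> [|x y [Hx cx] [Hy cy]|x [Hx cx]].
- by split=> [|h _]; [apply: memg1|rewrite comm1g].
- split; first exact: memgM.
  move=> h Th; apply/eqP/commgP/commute_sym/commuteM; apply/commute_sym/commgP/eqP.
    exact: cx.
  exact: cy.
- split; first exact: memgV.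
  move=> h Th; apply/eqP/commgP/commute_sym/commuteV/commute_sym/commgP/eqP.
  exact: cx.
Qed.

Lemma center_normal H : normal H -> normal (center H).
Proof.
move=> [gH nH]; split; first exact: centralizer_subgroup.
move=> z g [Hz cz]; split; first exact: nH.
move=> h Hh; rewrite -(conjgKV g h) -conjRg cz ?conj1g //.
exact: nH.
Qed.

Lemma center_abelian H : abelian (center H).
Proof. by move=> x y [_ cx] [Hy _]; apply/commgP/eqP/cx. Qed.

(** The centre is the intersection of the centralizers of finitely many
    generators, and each step of this intersection remains infinite. *)
Lemma infinite_center H K : subgroup H -> infinite_set H -> finite_set K ->
  (forall x y, H x -> H y -> K [~ x, y]) -> infinite_set (center H).
Proof.
move=> gH iH fK HK; have [S /finite_seqP[s ->] SE] := fgG gH.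
have sH x : x \in s -> H x by move=> xs; rewrite -SE; apply: sub_generated.
suff key (t : seq G) : {subset t <= s} -> infinite_set (centralizer H [set` t]).
  have := key s (fun _ => id); apply: sub_infinite_set => z [Hz cz]; split=> //.
  have gP : subgroup [set h | [~ z, h] = 1].
    split=> [|x y /= /eqP/commgP cx /eqP/commgP cy|x /= /eqP/commgP cx].
    - exact: commg1.
    - by apply/eqP/commgP/commuteM.
    - by apply/eqP/commgP/commuteV.
  by rewrite -SE; apply: (generated_sub gP) => x /cz.
elim: t => [|x t IH] ts.
  by move: iH; apply: sub_infinite_set => z Hz; split.
have iT : infinite_set (centralizer H [set` t]).
  by apply: IH => y yt; apply: ts; rewrite inE yt orbT.
have Hx : H x by apply/sH/ts/mem_head.
have gC := @centralizer_subgroup H [set` t] gH.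
have := @infinite_centralizer1 _ x K gC iT fK (fun h Hh => HK h x Hh.1 Hx).
apply: sub_infinite_set => z [[Hz cz] zx]; split=> // y /=.
by rewrite inE => /predU1P[->|/cz].
Qed.

(** The centre of the last infinite term of the derived series, whose derived
    subgroup is the next term, hence finite. *)
Lemma infinite_abelian_normal : soluble G -> infinite_set [set: G] ->
  exists A, [/\ normal A, abelian A & infinite_set A].
Proof.
move=> [n Dn] iG.
have exF : exists m, `[< finite_set (derived_series G m) >].
  by exists n; apply/asboolP; rewrite Dn; apply: finite_set1.
have [[|m] /asboolP fD Dmin] := ex_minnP exF; first by case: iG.
exists (center (derived_series G m)); split.
- exact/center_normal/derived_normal.
- exact: center_abelian.
apply: (@infinite_center _ (derived_series G m.+1)) => //.
- exact: derived_subgroup.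
- by move=> fDm; have /asboolP/Dmin := fDm; rewrite ltnn.
- exact: derivedR.
Qed.

(** Adding a generator [g] to an abelian group multiplies its order by at most
    [m]. *)
Lemma finite_exponent A m : fg_subgroup A -> abelian A -> (0 < m)%N ->
  (forall a, A a -> a ^+ m = 1) -> finite_set A.
Proof.
move=> fA cA m_gt0; elim/fg_subgroup_ind: fA cA => [_ _|g S fS IH cA Am].
  exact: finite_set1.
have SA : generated S `<=` generated (g |` S).
  by apply: generated_mono => x; right.
have gA : generated (g |` S) g by apply: sub_generated; left.
have {}IH : finite_set (generated S).
  by apply: IH => [x y /SA Sx /SA Sy|x /SA]; [apply: cA|apply: Am].
pose F i := [set g ^+ i * x | x in generated S].
apply: (@sub_finite_set _ _ (\bigcup_(i in `I_m) F i)); last first.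
  by apply: bigcup_finite => [|i _]; [apply: finite_II|apply: finite_image].
have modm i : g ^+ i = g ^+ (i %% m).
  by rewrite {1}(divn_eq i m) expgnDr mulnC expgnA Am // expg1n mul1g.
have FP i x : generated S x -> (\bigcup_(i in `I_m) F i) (g ^+ i * x).
  by move=> Sx; exists (i %% m)%N; [apply: ltn_pmod|exists x; rewrite // -modm].
have gS := generated_subgroup S.
have cg i x : generated S x -> g ^+ i * x = x * g ^+ i.
  by move=> /SA Sx; apply/commute_sym/commuteX/cA.
have gF : subgroup (\bigcup_(i in `I_m) F i).
  split=> [|_ _ [i _ [x Sx <-]] [j _ [y Sy <-]]|_ [i /= im [x Sx <-]]].
  - by have := FP 0%N 1 (memg1 gS); rewrite expg0 mulg1.
  - have -> : g ^+ i * x * (g ^+ j * y) = g ^+ (i + j) * (x * y).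
      by rewrite expgnDr !mulgA -(mulgA (g ^+ i)) -cg // !mulgA.
    by apply: FP; apply: (memgM gS).
  - have -> : (g ^+ i * x)^-1 = g ^+ (m - i) * x^-1.
      rewrite cg // invgM expgnFr ?(ltnW im) // Am // mul1g.
      by [].
    by apply: FP; apply: (memgV gS).
apply: (generated_sub gF) => x [->|Sx].
  by have := FP 1%N 1 (memg1 gS); rewrite expg1 mulg1.
by have := FP 0%N x (sub_generated Sx); rewrite expg0 mul1g.
Qed.

(** The torsion elements form a subgroup, which is finitely generated; the
    product of the orders of its generators kills it. *)
Lemma torsion_exponent A : subgroup A -> abelian A -> exists2 m, (0 < m)%N &
  forall a n, A a -> (0 < n)%N -> a ^+ n = 1 -> a ^+ m = 1.
Proof.
move=> gA cA; pose T := [set a | A a /\ exists2 n, (0 < n)%N & a ^+ n = 1].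
have gT : subgroup T.
  split=> [|x y [Ax [m m0 xm]] [Ay [n n0 yn]]|x [Ax [n n0 xn]]].
  - by split; [apply: memg1|exists 1%N => //; rewrite expg1n].
  - split; first exact: memgM.
    exists (m * n)%N; first by rewrite muln_gt0 m0.
    rewrite expgMn; last exact: cA.
    by rewrite expgnA xm mulnC expgnA yn !expg1n mulg1.
  - by split; [apply: memgV|exists n; rewrite // expVgn xn invg1].
have [S /finite_seqP[s ->] SE] := fgG gT.
have sT x : x \in s -> T x by move=> xs; rewrite -SE; apply: sub_generated.
have [m m0 sm] : exists2 m, (0 < m)%N & forall x, x \in s -> x ^+ m = 1.
  elim: s sT {SE} => [|x s IH] sT; first by exists 1%N.
  have [|m m0 sm] := IH; first by move=> y ys; apply: sT; rewrite inE ys orbT.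
  have [_ [n n0 xn]] := sT x (mem_head _ _).
  exists (m * n)%N; first by rewrite muln_gt0 m0.
  move=> y; rewrite inE => /predU1P[->|/sm ym].
    by rewrite mulnC expgnA xn expg1n.
  by rewrite expgnA ym expg1n.
exists m => // a n Aa n0 an.
have gP : subgroup [set x | A x /\ x ^+ m = 1].
  split=> [|x y [Ax xm] [Ay ym]|x [Ax xm]].
  - by split; [apply: memg1|rewrite expg1n].
  - by split; [apply: memgM|rewrite expgMn ?xm ?ym ?mulg1 //; apply: cA].
  - by split; [apply: memgV|rewrite expVgn xm invg1].
have : T a by split=> //; exists n.
rewrite -SE => Sa; apply: (generated_sub gP _ Sa).2 => x /= xs.
by split; [have [] := sT x xs|apply: sm].
Qed.

Definition right_Engel x : Prop := forall y, exists k, iter_comm x k y = 1.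

Lemma right_Engel_normal : soluble G -> infinite_set [set: G] ->
  Engel_sequences G ->
  exists B, [/\ normal B, B `<=` right_Engel & exists2 b, B b & b <> 1].
Proof.
move=> solG iG EG; have [A [nA cA iA]] := infinite_abelian_normal solG iG.
have gA := nA.1; have [m m0 mP] := torsion_exponent gA cA.
exists [set a ^+ m | a in A]; split.
- split; last first.
    by move=> _ g [a Aa <-]; exists (a ^ g); rewrite -?conjXg //; apply: nA.2.
  split=> [|_ _ [a Aa <-] [b Ab <-]|_ [a Aa <-]].
  + by exists 1; [apply: memg1|rewrite expg1n].
  + by exists (a * b); [apply: memgM|rewrite expgMn //; apply: cA].
  + by exists a^-1; [apply: memgV|rewrite expVgn].
- move=> _ [a Aa <-] y.
  have [i [j [k [ij E]]]] :=
    Engel_abelian_sequence nA cA y EG (fun i => memgX gA i Aa).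
  exists k; rewrite (iter_commX nA cA) //; apply: (mP _ (j - i)%N).
  + exact: normal_iter_comm.
  + by rewrite subn_gt0.
  + rewrite -(iter_commX nA cA) // -E; congr iter_comm.
    by rewrite -{2}(subnKC (ltnW ij)) expgnDr mulKg.
- apply: contrapT => noB; apply: iA; apply: (@finite_exponent _ m) => //.
    exact: fgG.
  move=> a Aa; apply: contrapT => am; apply: noB.
  by exists (a ^+ m) => //; exists a.
Qed.

End InfiniteNoetherian.

(** * Cliques and right Engel elements *)

(** Such subgroups are closed under unions of nonempty chains. The empty set is
    added to the family to account for the union of the empty chain; it is not
    maximal, being contained in the trivial subgroup. *)
Lemma maximal_right_Engel_normal (G : groupType) : exists2 R : set G,
  normal R /\ R `<=` @right_Engel G &
  forall B, normal B -> B `<=` @right_Engel G -> R `<=` B -> B `<=` R.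
Proof.
pose good (X : set G) := normal X /\ X `<=` @right_Engel G.
have good1 : good [set 1].
  split; last by move=> _ -> y; exists 0%N.
  by split; [apply: subgroup1|move=> _ g ->; rewrite /= conj1g].
have [F FP totF|R [R0P Rmax]] := @Zorn_bigcup G [set X | X = set0 \/ good X].
  have [[X FX [gX _]]|noX] := pselect (exists2 X, F X & good X); last first.
    left; apply/seteqP; split=> // x [X FX Xx]; case: (FP X FX) => [X0|gX].
      by rewrite X0 in Xx.
    by case: noX; exists X.
  have FN Y y : F Y -> Y y -> good Y.
    by move=> FY Yy; case: (FP Y FY) => // Y0; rewrite Y0 in Yy.
  right; split; last by move=> x [Y FY Yx]; apply: (FN Y x FY Yx).2.
  split; last by move=> x g [Y FY Yx]; exists Y => //; apply: (FN Y x FY Yx).1.2.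
  split=> [|x y [Y FY Yx] [Z FZ Zy]|x [Y FY Yx]].
  - by exists X => //; apply: memg1 gX.1.
  - have gY := (FN Y x FY Yx).1.1; have gZ := (FN Z y FZ Zy).1.1.
    have [YZ|ZY] := totF Y Z FY FZ.
      by exists Z => //; apply: (memgM gZ) => //; apply: YZ.
    by exists Y => //; apply: (memgM gY) => //; apply: ZY.
  - by exists Y => //; apply: (memgV (FN Y x FY Yx).1.1).
have gR : good R.
  case: R0P => // R0; case: (Rmax [set 1]); last by right.
  rewrite R0; split=> // /(_ 1); exact.
exists R => // B nB BE RB; apply: contrapT => nBR.
by apply: (Rmax B) => //; right.
Qed.

(** Right Engel elements of G/R come from right Engel elements of G when R is
    made of right Engel elements: if [x,_k y] is in R then [[x,_k y],_l y] = 1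
    for some l. So a maximal R leaves an infinite quotient no room. *)
Theorem right_Engel_finite_index (G : groupType) :
  finitely_generated G -> soluble G -> Engel_sequences G ->
  exists (Q : groupType) (f : group_morphism G Q),
    finite_set [set: Q] /\ forall x, f x = 1 -> right_Engel x.
Proof.
move=> fG [n DG] EG; have [R [nR RE] Rmax] := maximal_right_Engel_normal G.
have [Q [f [f_surj kerf]]] := quotient_exists nR.
exists Q, f; split; last by move=> x /kerf/RE.
apply: contrapT => iQ.
have EQ : Engel_sequences Q := Engel_sequences_quotient f_surj EG.
have DQ : derived_series Q n = [set 1].
  apply/seteqP; split=> [q /(image_derived_series f_surj)[x + <-]|_ ->].
    by rewrite DG => ->; apply: gmulf1.
  exact: memg1 (derived_subgroup _ _).
have nQ : noetherian [set: Q].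
  apply: (@polycyclic_noetherian _ [set 1]); [exact: subgroup1|exact: noetherian1|].
  exact: (Engel_soluble_polycyclic (finitely_generated_quotient f_surj fG) DQ EQ).
have [|B [nB BE [b Bb b1]]] := right_Engel_normal nQ _ iQ EQ; first by exists n.
have [x xb] := f_surj b; apply: b1; rewrite -xb; apply/kerf.
apply: (Rmax (f @^-1` B)).
- split; first exact: preimage_subgroup nB.1.
  by move=> z g Bz; rewrite /= gmulfJ; apply: nB.2.
- move=> z /BE Ez y; have [k] := Ez (f y).
  rewrite -morph_iter_comm => /kerf/RE/(_ y)[l E].
  by exists (l + k)%N; rewrite iter_commD.
- by move=> z /kerf /= ->; apply: memg1 nB.1.
- by rewrite /= xb.
Qed.

Theorem theorem1p1 (G : groupType)
    (fgG : finitely_generated G) (solG : soluble G) (nEG : ~ Engel_group G) :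
  ~ has_infinite_clique (Engel_graph G) <->
  finite_clique_number (Engel_graph G).
Proof.
split=> [noC|[n nP] [C [cC iC]]]; last first.
  by apply/iC/finite_set_leP; exists n; apply: nP.
have [Q [f [fQ kerf]]] :=
  right_Engel_finite_index fgG solG (no_infinite_clique_sequences noC).
have [n Qn] := (finite_set_leP _).1 fQ.
exists n => C [_ cC]; apply: card_le_trans Qn.
have fI : {in C &, injective f}.
  move=> x y /set_mem Cx /set_mem Cy fxy; apply: contrapT => xy.
  (* x = y r with r right Engel, and [y r, y] = [r, y] *)
  have /kerf/(_ y)[k E] : f (y^-1 * x) = 1 by rewrite gmulfM gmulfV fxy mulVg.
  have [_ _ _ /(_ k.+1 isT)[+ _]] := cC x y Cx Cy xy; apply.
  rewrite iter_commSr; have -> : [~ x, y] = [~ y^-1 * x, y].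
    by rewrite /commg /conjg !gnorm.
  by rewrite -iter_commSr iter_commS E comm1g.
by rewrite -(card_le_eql (inj_card_eq fI)); apply: card_leT.
Qed.
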